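(* Let $\mathcal S$ be $\mathbb R^n$ or $\mathbb C^n$, let $\mathcal D\subseteq\mathcal S$ be a domain, and let $p$ be a polynomial over $\mathcal S$ with variety $V(p)$. Let $G(p)$ be the set of points in general position on $V(p)$. If there exists $x\in\mathcal D\cap G(p)$ such that $\mathrm{Allow}(x)\cap\mathrm{Int}(\mathcal D)\neq\emptyset$, then $p$ is not accurately evaluable on $\mathcal D$ in classical rounded arithmetic.
   Context: **Classical rounded arithmetic.** Let $\mathcal S\in\{\mathbb R^n,\mathbb C^n\}$. An algorithm receives its input $x=(x_1,\dots,x_n)\in\mathcal S$ exactly. It is a finite directed acyclic graph (DAG) with source nodes carrying the variables $x_i$, computational nodes, possibly branching nodes, and one output (destination) node per branch. Each computational node has two inputs (each a source or the output of another computational node; both inputs may come from the same node), each of which may be negated exactly before use; the node performs one operation $op\in\{+,-,\cdot\}$ and outputs $op(a,b)(1+\delta_i)$, where $\delta_i$ is a rounding error variable specific to that node (different nodes have independent errors). The $\delta_i$ are real if $\mathcal S=\mathbb R^n$ and complex if $\mathcal S=\mathbb C^n$, and otherwise arbitrary subject to $|\delta_i|\le\epsilon$, where $0<\epsilon<1$ is the machine precision. No constants are available. Branching nodes compare intermediate quantities exactly ($<,=,>$ for real data, $=$ for complex data) and the algorithm continues according to the outcome; an algorithm without branching nodes is called non-branching. The output on input $x$ with error vector $\delta=(\delta_1,\dots,\delta_m)$ is $p_{comp}(x,\delta)$; an algorithm for $p$ must satisfy $p_{comp}(x,0)=p(x)$. **Accuracy.** The algorithm is accurate for $p$ on $\mathcal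 D$ if for every $0<\eta<1$ there is $0<\epsilon<1$ such that for all $x\in\mathcal D$ and all $\delta$ with $|\delta_i|\le\epsilon$ for all $i$: $|p_{comp}(x,\delta)-p(x)|\le\eta|p(x)|$. The polynomial $p$ is accurately evaluable on $\mathcal D$ if some (branching or non-branching) algorithm is accurate for $p$ on $\mathcal D$. **Allowability.** $V(p)=\{x\in\mathcal S: p(x)=0\}$. The allowable hyperplanes are $Z_i=\{x:x_i=0\}$, $S_{ij}=\{x:x_i+x_j=0\}$, $D_{ij}=\{x:x_i-x_j=0\}$. $V(p)$ is allowable if it is a union of intersections of allowable hyperplanes, and unallowable otherwise. The set $G(p)$ of points in general position is $V(p)$ minus the union of all those sets $W\subseteq V(p)$ that are finite intersections of allowable hyperplanes (the empty intersection being $\mathcal S$). For $x\in\mathcal S$, $\mathrm{Allow}(x)$ is the intersection of all allowable hyperplanes containing $x$, with $\mathrm{Allow}(x)=\mathcal S$ if there are none. $\mathrm{Int}$ denotes the topological interior. *)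

(* Defs.v *)
From mathcomp Require Import all_boot all_order all_algebra.
From mathcomp Require Import complex.
From mathcomp Require Import boolp classical_sets cardinality reals topology normedtype.
From mathcomp Require mpoly.
Set Implicit Arguments.
Unset Strict Implicit.
Unset Printing Implicit Defensive.
Import Order.TTheory GRing.Theory Num.Theory.
Import numFieldNormedType.Exports.
Local Open Scope classical_set_scope.
Local Open Scope ring_scope.

Inductive scalar_kind := RealScalars | ComplexScalars.

Definition scalar_field (R : realType) (s : scalar_kind) : numFieldType :=
  match s with RealScalars => R | ComplexScalars => R[i] end.

Definition outcome (s : scalar_kind) : Type :=
  match s with RealScalars => comparison | ComplexScalars => bool end.

Definition compare_real (R : realType) (a b : R) : comparison :=
  if a < b then Lt else if a == b then Eq else Gt.

Definition compare_exact (R : realType) (s : scalar_kind) :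
    scalar_field R s -> scalar_field R s -> outcome s :=
  match s with
  | RealScalars => fun a b => compare_real a b
  | ComplexScalars => fun a b => a == b
  end.

Inductive operation := Add | Sub | Mul.

(* [Q] is the type of the quantities available so far, initially the source
   nodes ['I_n].  [Compute] adds a computational node: in what follows it, the
   new value is [None] and an older quantity [q] is [Some q].  The boolean in
   an operand tells whether that input is negated.  The DAG is thus listed in
   topological order, and it splits at each branching node into one
   continuation per outcome in [O]. *)
Inductive algorithm (O Q : Type) : Type :=
| Output (q : Q)
| Compute (op : operation) (l r : bool * Q) (next : algorithm O (option Q))
| Branch (l r : Q) (next : O -> algorithm O Q).

(* Every computational node, on whichever branch, has its own error variable. *)
Fixpoint comp_node (O Q : Type) (a : algorithm O Q) : Type :=
  match a with
  | Output _ => void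
  | Compute _ _ _ next => option (comp_node next)
  | Branch _ _ next => {o : O & comp_node (next o)}
  end.

Section Evaluation.
Variables (R : realType) (s : scalar_kind).
Local Notation K := (scalar_field R s).

Definition operand (Q : Type) (v : Q -> K) (u : bool * Q) : K :=
  if u.1 then - v u.2 else v u.2.

Definition apply_op (op : operation) (a b : K) : K :=
  match op with Add => a + b | Sub => a - b | Mul => a * b end.

Definition extend (Q : Type) (v : Q -> K) (y : K) (q : option Q) : K :=
  if q is Some q' then v q' else y.

Fixpoint eval_algorithm (Q : Type) (a : algorithm (outcome s) Q) :
    (Q -> K) -> (comp_node a -> K) -> K :=
  match a with
  | Output q => fun v _ => v q
  | Compute op l r next => fun v delta =>
      eval_algorithm (extend v (apply_op op (operand v l) (operand v r)
                      * (1 + delta None)))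
           (fun i => delta (Some i))
  | Branch l r next => fun v delta =>
      let o := compare_exact (v l) (v r) in
      @eval_algorithm _ (next o) v (fun i => delta (existT _ o i))
  end.

Variable n : nat.
Implicit Types (p : mpoly.mpoly n K) (D : set 'rV[K]_n) (x : 'rV[K]_n).

Definition peval p x : K := mpoly.meval (fun i => x ord0 i) p.

Definition p_comp (a : algorithm (outcome s) 'I_n) x
    (delta : comp_node a -> K) : K :=
  eval_algorithm (fun i => x ord0 i) delta.

Definition algorithm_for p (a : algorithm (outcome s) 'I_n) : Prop :=
  forall x, p_comp x (fun _ : comp_node a => 0) = peval p x.

(* In the order of [R[i]], [0 < eps < 1] forces [eps] to be real. *)
Definition accurate (a : algorithm (outcome s) 'I_n) p D : Prop :=
  forall eta : K, 0 < eta < 1 ->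
  exists2 eps : K, 0 < eps < 1 &
    forall x (delta : comp_node a -> K), D x ->
      (forall i, `|delta i| <= eps) ->
      `|p_comp x delta - peval p x| <= eta * `|peval p x|.

Definition accurately_evaluable p D : Prop :=
  exists a : algorithm (outcome s) 'I_n, algorithm_for p a /\ accurate a p D.

Definition variety p : set 'rV[K]_n := [set x | peval p x = 0].

(* S_ii = Z_i, and D_ii is not a hyperplane. *)
Definition allowable_hyperplane (H : set 'rV[K]_n) : Prop :=
  [\/ exists i, H = [set x | x ord0 i = 0],
      exists i j, i != j /\ H = [set x | x ord0 i + x ord0 j = 0]
    | exists i j, i != j /\ H = [set x | x ord0 i - x ord0 j = 0]].

Definition allowable_intersection (W : set 'rV[K]_n) : Prop :=
  exists F : set (set 'rV[K]_n),
    [/\ finite_set F, F `<=` allowable_hyperplane & W = \bigcap_(H in F) H].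

Definition general_position p : set 'rV[K]_n :=
  variety p `\`
  \bigcup_(W in [set W | allowable_intersection W /\ W `<=` variety p]) W.

Definition Allow x : set 'rV[K]_n :=
  \bigcap_(H in [set H | allowable_hyperplane H /\ H x]) H.

End Evaluation.

(* Main.v *)
Require Import Defs.
From mathcomp Require Import all_boot all_order all_algebra.
From mathcomp Require Import complex.
From mathcomp Require Import boolp classical_sets cardinality reals topology normedtype.
From mathcomp Require mpoly.
From mathcomp Require Import ring.
Import Order.TTheory GRing.Theory Num.Theory.
Import numFieldNormedType.Exports.
Local Open Scope classical_set_scope.
Local Open Scope ring_scope.

(** The rounding errors are so free that an accurate algorithm run at [x] can
    be made to behave as its exact run at a neighbouring point [z].

    Let [x] be in general position.  Then [p] vanishes at [x] but not on all of
    [Allow x], so on the line from [x] to a point of [Allow x] where [p] is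
    nonzero there are points [z] as near to [x] as wanted with [p z <> 0]
    ([general_position_nonvanishing], [exists_near_id_to]).  As [z] lies in
    [Allow x], every coincidence [x_i = x_j] or [x_i = - x_j] also holds
    between coordinates of [z], while coordinates of [x] that differ stay
    apart in [z]; hence there is an odd function [phi] with [phi z_i = x_i]
    such that [phi - id] has a small Lipschitz constant [L].  It is built from
    tent functions centred at the [z_i] and [- z_i].

    Run the algorithm exactly at [z], and let [v] be the value of a node.
    At [x], the errors can be chosen so that this node has the value [phi v]
    ([exact_run_emulated]).  Indeed [op (phi a) (phi b)] and [phi (op a b)] are
    both equal to [op a b] up to a relative error of order [L], and the error
    variable of the node can absorb the quotient; oddness of [phi] takes care
    of the negated inputs.  When [L < 1], [phi] is injective, and increasing
    over the reals, so that every branching node has the same outcome in both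
    runs.  The output at [x] is then [phi (p z)], which is nonzero because
    [p z] is and [phi 0 = 0].  But [p x = 0], so accuracy at [x] forces the
    output there to be [0] for all small errors.

    The emulation replaces any genericity argument on the errors, and treats
    real and complex data, with or without branching, in the same way. *)

Set Implicit Arguments.
Unset Strict Implicit.
Unset Printing Implicit Defensive.

(** * Odd perturbations of the identity commute with rounded operations *)

(** If [A] and [C] are both relatively close to [u], then [C] is a rounded
    value of [A].  When [u = 0] both vanish and no error is needed; otherwise
    [4 * e <= 1] keeps [|A|] above [|u| / 4], so the quotient [C / A] is
    within [16 * e] of [1]. *)
Lemma absorb_rounding (K : numFieldType) (e A C u : K) :
  0 <= e -> 4 * e <= 1 ->
  `|A - u| <= 3 * e * `|u| -> `|C - u| <= e * `|u| ->
  exists d : K, `|d| <= 16 * e /\ A * (1 + d) = C.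
Proof.
move=> e0 e1 hA hC.
have [u0|u0] := eqVneq u 0.
  move: hA hC; rewrite u0 normr0 !mulr0 !subr0 !normr_le0 => /eqP -> /eqP ->.
  by exists 0; rewrite normr0 mul0r; split => //; exact: mulr_ge0.
have hu : `|u| <= 4 * `|A|.
  have h1 : `|u| <= `|A| + `|A - u|.
    by rewrite -[u in `|u|](subKr A); exact: ler_normB.
  have h2 : 3 * (4 * e) * `|u| <= 3 * 1 * `|u|.
    by rewrite ler_wpM2r // ler_wpM2l.
  rewrite -subr_ge0.
  have -> : 4 * `|A| - `|u| = 4 * (`|A| + `|A - u| - `|u|)
     + 4 * (3 * e * `|u| - `|A - u|) + (3 * 1 * `|u| - 3 * (4 * e) * `|u|).
    by ring.
  by apply: addr_ge0; [apply: addr_ge0; apply: mulr_ge0|]; rewrite ?subr_ge0.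
have A0 : A != 0.
  apply: contra_neq u0 => A0; apply/eqP.
  by rewrite -normr_le0; rewrite A0 normr0 mulr0 in hu.
exists ((C - A) / A); split; last by field.
rewrite normrM normfV ler_pdivrMr ?normr_gt0 //.
have h : `|C - A| <= e * `|u| + 3 * e * `|u|.
  have -> : C - A = (C - u) - (A - u) by ring.
  by rewrite (le_trans (ler_normB _ _)) // lerD.
apply: le_trans h _.
have -> : e * `|u| + 3 * e * `|u| = (4 * e) * `|u| by ring.
have -> : 16 * e * `|A| = (4 * e) * (4 * `|A|) by ring.
by rewrite ler_wpM2l // mulr_ge0.
Qed.

(** The Lipschitz bound on [phi - id] also gives [phi t = t (1 + theta)] with
    [|theta| <= L], since an odd function vanishes at [0]. *)
Definition odd_near_id (K : numFieldType) (L : K) (phi : K -> K) : Prop :=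
  (forall t, phi (- t) = - phi t) /\
  (forall s t, `|phi s - phi t - (s - t)| <= L * `|s - t|).

Lemma odd_near_id0 (K : numFieldType) (L : K) phi :
  odd_near_id L phi -> phi 0 = 0.
Proof.
move=> [podd _]; apply/eqP; have /eqP := podd 0.
by rewrite oppr0 -addr_eq0 -mulr2n mulrn_eq0.
Qed.

Lemma odd_near_id_dist (K : numFieldType) (L : K) phi t :
  odd_near_id L phi -> `|phi t - t| <= L * `|t|.
Proof.
by move=> hphi; have := hphi.2 t 0; rewrite (odd_near_id0 hphi) !subr0.
Qed.

Lemma odd_near_id_inj (K : numFieldType) (L : K) phi :
  L < 1 -> odd_near_id L phi -> injective phi.
Proof.
move=> L1 [_ pL] u v uv; have := pL u v; rewrite uv subrr sub0r normrN.
rewrite -subr_ge0 -[X in _ - X]mul1r -mulrBl nmulr_rge0 ?subr_lt0 //.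
by rewrite normr_le0 subr_eq0 => /eqP.
Qed.

Lemma odd_near_id_homo (R : realFieldType) (L : R) phi :
  L < 1 -> odd_near_id L phi -> {homo phi : u v / u < v}.
Proof.
move=> L1 [_ pL] u v; rewrite -subr_gt0 => vu; rewrite -subr_gt0.
have := pL v u; rewrite (gtr0_norm vu) ler_norml => /andP[h _].
have -> : phi v - phi u = (phi v - phi u - (v - u) + L * (v - u))
   + (1 - L) * (v - u) by ring.
rewrite ltr_wpDl // ?mulr_gt0 // ?subr_gt0 //.
by rewrite -[X in _ + X]opprK subr_ge0.
Qed.

(** A sum is the difference [a - (- b)], so oddness reduces it to the Lipschitz
    bound; for a product, [phi] scales each factor by at most [1 + L], and
    [L <= 1] bounds the quadratic term by a linear one. *)
Lemma apply_op_near_id (R : realType) (s : scalar_kind)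
    (L : scalar_field R s) phi op a b :
  0 <= L -> 4 * L <= 1 -> odd_near_id L phi ->
  exists d, `|d| <= 16 * L /\
    apply_op op (phi a) (phi b) * (1 + d) = phi (apply_op op a b).
Proof.
move=> L0 L1 hphi; have [podd pL] := hphi.
apply: (@absorb_rounding _ L _ _ (apply_op op a b)) => //; last first.
  exact: odd_near_id_dist.
have le3 (t : scalar_field R s) : L * `|t| <= 3 * L * `|t|.
  by rewrite ler_wpM2r // ler_peMl // ler1n.
case: op => /=.
- have -> : phi a + phi b - (a + b) = phi a - phi (- b) - (a - - b).
    by rewrite podd; ring.
  by rewrite -[b in leRHS]opprK (le_trans (pL _ _)).
- exact: le_trans (pL _ _) (le3 _).
have -> : phi a * phi b - a * b =
  (phi a - a) * (phi b - b) + (phi a - a) * b + a * (phi b - b) by ring.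
have ha := odd_near_id_dist a hphi; have hb := odd_near_id_dist b hphi.
rewrite (le_trans (ler_normD _ _)) // .
have -> : 3 * L * `|a * b| = L * `|a| * `|b| + L * `|a| * `|b| + `|a| * (L * `|b|).
  by rewrite normrM; ring.
rewrite lerD //; last by rewrite normrM ler_wpM2l.
rewrite (le_trans (ler_normD _ _)) // lerD // normrM.
  have hb' : `|phi b - b| <= `|b|.
    rewrite (le_trans hb) // ler_piMl // (le_trans _ L1) //.
    by rewrite ler_peMl // ler1n.
  exact: ler_pM.
by rewrite ler_wpM2r.
Qed.

(** * Emulating an exact run by a rounded run at another point *)

Lemma compare_exact_near_id (R : realType) (s : scalar_kind)
    (L : scalar_field R s) phi a b :
  L < 1 -> odd_near_id L phi ->
  compare_exact (phi a) (phi b) = compare_exact a b.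
Proof.
case: s L phi a b => /= L phi a b L1 hphi.
  have mono := le_mono (odd_near_id_homo L1 hphi).
  by rewrite /compare_real (leW_mono mono) (inj_eq (inc_inj mono)).
by rewrite (inj_eq (odd_near_id_inj L1 hphi)).
Qed.

(** The nodes are independent, so the errors can be chosen one after the other
    along the topological order, each one forcing its node onto the [phi]-image
    of the exact value. *)
Lemma exact_run_emulated (R : realType) (s : scalar_kind)
    (L : scalar_field R s) phi :
  0 < L -> 4 * L <= 1 -> odd_near_id L phi ->
  forall (Q : Type) (a : algorithm (outcome s) Q) (v w : Q -> scalar_field R s),
    (forall q, w q = phi (v q)) ->
  exists delta : comp_node a -> scalar_field R s,
    (forall i, `|delta i| <= 16 * L) /\
    eval_algorithm w delta = phi (eval_algorithm v (fun _ : comp_node a => 0)).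
Proof.
move=> L0 L1 hphi Q a.
elim: a => {Q} [Q q|Q op l r next IH|Q l r next IH] v w vw.
- by exists (fun _ => 0); split=> [[]|] /=.
- have [podd _] := hphi.
  have operandE u : operand w u = phi (operand v u).
    by rewrite /operand vw; case: ifP; rewrite ?podd.
  have [d [hd dE]] :=
    apply_op_near_id op (operand v l) (operand v r) (ltW L0) L1 hphi.
  have [|delta [hdelta deltaE]] := IH
    (extend v (apply_op op (operand v l) (operand v r) * (1 + 0)))
    (extend w (phi (apply_op op (operand v l) (operand v r)))).
    by case=> [q|] //=; rewrite addr0 mulr1.
  exists (fun i => if i is Some j then delta j else d); split; first by case.
  by rewrite /= -deltaE !operandE dE.
have L_lt1 : L < 1 by rewrite (lt_le_trans _ L1) // ltr_pMl ?ltr1n.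
(* Only one branch is taken, but the error family is indexed by the nodes of
   all branches: choose suitable errors on each of them. *)
pose delta o := projT1 (cid (IH o v w vw)).
exists (fun i => delta (projT1 i) (projT2 i)); split => [[o i]|] /=.
  by have [h _] := projT2 (cid (IH o v w vw)); exact: h.
rewrite !vw (compare_exact_near_id _ _ L_lt1 hphi).
by have [_ ->] := projT2 (cid (IH (compare_exact (v l) (v r)) v w vw)).
Qed.

(** * Odd Lipschitz interpolation by tent functions *)

Section TentInterpolation.
Variable K : numFieldType.
Implicit Types (r u v : K).

Definition tent r u : K := if `|u| <= r then 1 - `|u| / r else 0.

Lemma tent0 r : 0 < r -> tent r 0 = 1.
Proof. by move=> /ltW r0; rewrite /tent normr0 r0 mul0r subr0. Qed.

Lemma tent_far r u : 0 < r -> r <= `|u| -> tent r u = 0.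
Proof.
move=> r0 ru; rewrite /tent; case: ifP => // ur.
have -> : `|u| = r by apply/eqP; rewrite eq_le ur.
by rewrite divff ?subrr // gt_eqF.
Qed.

Lemma tentN r u : tent r (- u) = tent r u.
Proof. by rewrite /tent normrN. Qed.

Lemma tent_lipschitz r u v :
  0 < r -> `|tent r u - tent r v| <= `|u - v| / r.
Proof.
move=> r0; rewrite ler_pdivlMr //.
have mixed a b : `|a| <= r -> ~~ (`|b| <= r) ->
    `|1 - `|a| / r| * r <= `|a - b|.
  move=> ar; rewrite -real_ltNge ?normr_real ?gtr0_real // => rb.
  have -> : `|1 - `|a| / r| = 1 - `|a| / r.
    by rewrite ger0_norm // subr_ge0 ler_pdivrMr // mul1r.
  rewrite mulrBl mul1r divfK ?gt_eqF // distrC.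
  by rewrite (le_trans _ (lerB_dist _ _)) // lerD2r ltW.
rewrite /tent; case: ifPn => ur; case: ifPn => vr.
- have -> : 1 - `|u| / r - (1 - `|v| / r) = (`|v| - `|u|) / r.
    by field; rewrite gt_eqF.
  rewrite normrM normfV (gtr0_norm r0) divfK ?gt_eqF // distrC.
  exact: ler_dist_dist.
- by rewrite subr0; exact: mixed.
- by rewrite sub0r normrN [in leRHS]distrC; exact: mixed.
by rewrite subrr normr0 mul0r.
Qed.

Variables (I : finType) (z c : I -> K).
Hypothesis c_eq : forall i j, z i = z j -> c i = c j.
Hypothesis c_opp : forall i j, z i = - z j -> c i = - c j.
Variable r : K.
Hypothesis r_gt0 : 0 < r.
Hypothesis sepB : forall i j, z i <> z j -> r <= `|z i - z j|.
Hypothesis sepD : forall i j, z i <> - z j -> r <= `|z i + z j|.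

(** The coordinates that agree up to sign with [z i] produce the same tents;
    dividing by their number makes these copies add up to one, which avoids
    choosing representatives.  The value [z i = 0] counts twice, harmlessly
    since then [c i = 0]. *)
Definition multiplicity (i : I) : nat :=
  \sum_j ((z i == z j) + (z i == - z j))%N.

Definition odd_tents (t : K) : K :=
  \sum_i c i / (multiplicity i)%:R * (tent r (t - z i) - tent r (t + z i)).

Lemma multiplicity_gt0 i : (0 < multiplicity i)%N.
Proof. by rewrite /multiplicity (bigD1 i) //= eqxx. Qed.

Lemma odd_tentsN t : odd_tents (- t) = - odd_tents t.
Proof.
rewrite /odd_tents -sumrN; apply: eq_bigr => i _.
have -> : - t - z i = - (t + z i) by ring.
have -> : - t + z i = - (t - z i) by ring.
by rewrite !tentN; ring.
Qed.

(** The tents have radius [r], which is at most the distance between distinct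
    centres: at [z k] only those centred at [z k] itself contribute.  There
    [c i = c k] if [z i = z k], and [c i = - c k] with a tent of opposite sign
    if [z i = - z k]. *)
Lemma odd_tents_interp k : odd_tents (z k) = c k.
Proof.
have tentB i : tent r (z k - z i) = (z k == z i)%:R.
  case: eqP => [->|/sepB]; first by rewrite subrr tent0.
  exact: tent_far.
have tentD i : tent r (z k + z i) = (z k == - z i)%:R.
  case: eqP => [->|/sepD]; first by rewrite addNr tent0.
  exact: tent_far.
have multE i : (z k == z i) || (z k == - z i) ->
    multiplicity i = multiplicity k.
  case/orP => /eqP zki; apply: eq_bigr => j _; first by rewrite zki.
  by rewrite zki eqr_oppLR eqr_opp addnC.
transitivity (\sum_i c k / (multiplicity k)%:R *
    ((z k == z i) + (z k == - z i))%N%:R).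
  apply: eq_bigr => i _; rewrite tentB tentD natrD.
  have := multE i; case: eqP => [e1|_]; case: eqP => [e2|_] //= h.
  - have ck0 : c k = 0.
      apply/eqP; rewrite -[_ == _](mulrn_eq0 _ 2) mulr2n addr_eq0.
      by rewrite {1}(c_eq e1) (c_opp e2) opprK.
    by rewrite -(c_eq e1) ck0 !mul0r.
  - by rewrite h // (c_eq e1) subr0 addr0.
  - by rewrite h // (c_opp e2); ring.
  by rewrite subr0 addr0 !mulr0.
rewrite -mulr_sumr -natr_sum divfK //.
by rewrite pnatr_eq0 -lt0n multiplicity_gt0.
Qed.

Lemma odd_tents_lipschitz s t :
  `|odd_tents s - odd_tents t| <= (2 / r * \sum_i `|c i|) * `|s - t|.
Proof.
rewrite /odd_tents -sumrB mulr_sumr mulr_suml.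
apply: le_trans (ler_norm_sum _ _ _) _; apply: ler_sum => i _.
rewrite -mulrBr normrM.
have -> : 2 / r * `|c i| * `|s - t| = `|c i| * (`|s - t| / r + `|s - t| / r).
  by field; rewrite gt_eqF.
apply: ler_pM => //.
  rewrite normrM ler_piMr // normfV normr_nat.
  by rewrite invf_le1 ?ler1n ?ltr0n multiplicity_gt0.
have -> : tent r (s - z i) - tent r (s + z i)
          - (tent r (t - z i) - tent r (t + z i)) =
    (tent r (s - z i) - tent r (t - z i))
    - (tent r (s + z i) - tent r (t + z i)) by ring.
apply: le_trans (ler_normB _ _) _; apply: lerD.
  by apply: le_trans (tent_lipschitz _ _ r_gt0) _; rewrite opprB addrA subrK.
by apply: le_trans (tent_lipschitz _ _ r_gt0) _; rewrite opprD addrACA subrr addr0.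
Qed.

Lemma odd_near_id_tents L :
  2 / r * \sum_i `|c i| <= L ->
  odd_near_id L (fun t => t + odd_tents t).
Proof.
move=> hL; split=> [t|s t]; first by rewrite odd_tentsN opprD.
have -> : s + odd_tents s - (t + odd_tents t) - (s - t) =
  odd_tents s - odd_tents t by ring.
by apply: le_trans (odd_tents_lipschitz s t) _; rewrite ler_wpM2r.
Qed.

End TentInterpolation.

(** * Points near [x] in [Allow x] where [p] does not vanish *)

Lemma polynomial_on_line (K : fieldType) n (p : mpoly.mpoly n K)
    (x d : 'I_n -> K) :
  exists P : {poly K}, forall t, P.[t] = mpoly.meval (fun i => x i + t * d i) p.
Proof.
exists (\sum_(m <- mpoly.msupp p) (mpoly.mcoeff m p)%:P *
  \prod_i ((x i)%:P + 'X * (d i)%:P) ^+ mpoly.fun_of_multinom m i) => t.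
rewrite mpoly.mevalE horner_sum; apply: eq_bigr => m _.
rewrite hornerM hornerC horner_prod; congr (_ * _); apply: eq_bigr => i _.
by rewrite horner_exp !hornerE.
Qed.

(** The numbers [tau / k.+1] are infinitely many candidates. *)
Lemma exists_small_nonroot (K : numFieldType) (P : {poly K}) (tau : K) :
  P != 0 -> 0 < tau -> exists t, [/\ 0 < t, t <= tau & P.[t] != 0].
Proof.
move=> P0 tau0; have taun0 : tau != 0 by rewrite gt_eqF.
pose rs := [seq tau / k.+1%:R | k <- iota 0 (size P)].
have rs_uniq : uniq rs.
  rewrite map_inj_uniq ?iota_uniq // => k l /(mulfI taun0).
  by move=> /invr_inj /eqP; rewrite eqr_nat => /eqP [].
have [/(max_poly_roots P0)/(_ rs_uniq)|/allPn[t /mapP[k _ ->] kP]] :=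
    boolP (all (root P) rs).
  by rewrite size_map size_iota ltnn.
exists (tau / k.+1%:R); split => //; first by rewrite divr_gt0 ?ltr0n.
by rewrite ler_pdivrMr ?ltr0n // ler_peMr ?ler1n // ltW.
Qed.

Lemma exists_separation (K : numFieldType) (s : seq K) :
  exists2 r : K, 0 < r & forall u, u \in s -> u != 0 -> r <= `|u|.
Proof.
elim: s => [|a s [r r0 hr]]; first by exists 1.
have [a0|a0] := eqVneq a 0.
  by exists r => // u; rewrite inE => /orP[/eqP ->|]; [rewrite a0 eqxx|exact: hr].
have na : 0 < `|a| by rewrite normr_gt0.
have ra : 0 < r + `|a| by exact: addr_gt0.
(* This value is below both [r] and [`|a|], and positive, without comparing
   the two in the partial order of [K]. *)
exists (r * `|a| / (r + `|a|)); first by rewrite !mulr_gt0 ?invr_gt0.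
move=> u; rewrite inE => /orP[/eqP ->|us] u0; rewrite ler_pdivrMr //.
  by rewrite mulrC ler_wpM2l // lerDl ltW.
apply: (@le_trans _ _ (r * (r + `|a|))).
  by rewrite ler_wpM2l ?ltW // ltrDr.
by rewrite ler_wpM2r ?(ltW ra) ?hr.
Qed.

Section AllowableHyperplanes.
Variables (R : realType) (s : scalar_kind) (n : nat).
Local Notation K := (scalar_field R s).
Implicit Types x y : 'rV[K]_n.

Lemma finite_allowable_hyperplanes :
  finite_set (@allowable_hyperplane R s n).
Proof.
pose hyp (q : 'I_n + ('I_n * 'I_n) * bool) : set 'rV[K]_n :=
  match q with
  | inl i => [set x | x ord0 i = 0]
  | inr ((i, j), true) => [set x | x ord0 i + x ord0 j = 0]
  | inr ((i, j), false) => [set x | x ord0 i - x ord0 j = 0]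
  end.
apply: (@sub_finite_set _ _ (range hyp)); last first.
  exact/finite_image/finite_finset.
move=> H [[i ->]|[i [j [_ ->]]]|[i [j [_ ->]]]].
- by exists (inl i).
- by exists (inr ((i, j), true)).
by exists (inr ((i, j), false)).
Qed.

Lemma allowable_intersection_Allow x : allowable_intersection (Allow x).
Proof.
exists [set H | allowable_hyperplane H /\ H x]; split => //.
  by apply: sub_finite_set finite_allowable_hyperplanes => H [].
by move=> H [].
Qed.

Lemma general_position_nonvanishing (p : mpoly.mpoly n K) x :
  general_position p x -> exists2 y, Allow x y & peval p y != 0.
Proof.
move=> [_ xW]; apply: contrapT => noy; apply: xW.
exists (Allow x); last by move=> H [].
split=> [|y xy]; first exact: allowable_intersection_Allow.
by apply/eqP; apply: contrapT => /negP py; apply: noy; exists y.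
Qed.

Lemma Allow_eq x y i j : Allow x y ->
  x ord0 i = x ord0 j -> y ord0 i = y ord0 j.
Proof.
have [->//|ij] := eqVneq i j.
move=> xy xij; apply: subr0_eq.
apply: (xy [set x | x ord0 i - x ord0 j = 0]); split; last first.
  by rewrite /= xij subrr.
by apply: Or33; exists i, j.
Qed.

(** For [i = j] the hypothesis says that [x] lies on the hyperplane [Z_i]. *)
Lemma Allow_opp x y i j : Allow x y ->
  x ord0 i = - x ord0 j -> y ord0 i = - y ord0 j.
Proof.
have [->|ij] := eqVneq i j => xy xij.
  have zero (u : K) : u = - u <-> u = 0.
    split => [uu|->]; last by rewrite oppr0.
    apply/eqP; rewrite -[_ == _](mulrn_eq0 u 2) mulr2n.
    by rewrite {1}uu addNr.
  apply/zero; apply: (xy [set x | x ord0 j = 0]); split; last exact/zero.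
  by apply: Or31; exists j.
apply/eqP; rewrite -addr_eq0; apply/eqP.
apply: (xy [set x | x ord0 i + x ord0 j = 0]); split; last first.
  by rewrite /= xij addNr.
by apply: Or32; exists i, j.
Qed.

End AllowableHyperplanes.

(** Take [z = x + t (y - x)] with [t] small.  Its distance to [x] is of order
    [t], while the separation of its coordinates, hence the radius of the tents
    that move [z_i] to [x_i], is bounded below independently of [t]: the
    Lipschitz constant of the displacement tends to [0] with [t]. *)
Lemma exists_near_id_to (R : realType) (s : scalar_kind) (n : nat)
    (p : mpoly.mpoly n (scalar_field R s)) (x y : 'rV[scalar_field R s]_n)
    (L : scalar_field R s) :
  0 < L -> L <= 1 -> Allow x y -> peval p y != 0 ->
  exists (z : 'rV[scalar_field R s]_n) phi,
    [/\ odd_near_id L phi, forall i, phi (z ord0 i) = x ord0 i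
      & peval p z != 0].
Proof.
move=> L0 L1 xy py.
pose xx i := x ord0 i; pose d i := y ord0 i - x ord0 i.
have [r r0 sep] := exists_separation
  ([seq xx i - xx j | i <- enum 'I_n, j <- enum 'I_n] ++
   [seq xx i + xx j | i <- enum 'I_n, j <- enum 'I_n]).
have [P PE] := polynomial_on_line p xx d.
have P0 : P != 0.
  apply: contra_neq py => P0; have := PE 1; rewrite P0 horner0 => ->.
  by apply: mpoly.meval_eq => i; rewrite mul1r /xx /d addrC subrK.
pose M := 1 + \sum_i `|d i|.
have M0 : 0 < M by rewrite ltr_pwDl // sumr_ge0.
have dM i : `|d i| <= M.
  by rewrite /M (bigD1 i) //= addrCA lerDl addr_ge0 ?ler01 ?sumr_ge0.
(* With [t * M <= r / 4] two coordinates of [x] at distance at least [r] are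
   still at distance [r / 2] in [z]; the factor [L] is for the Lipschitz
   constant, [t * M / (r / 4)] with tents of radius [r / 2]. *)
have tau0 : 0 < L * (r / 4) / M by rewrite !mulr_gt0 ?invr_gt0 ?ltr0n.
have [t [t0 ttau Pt]] := exists_small_nonroot P0 tau0.
have tML : t * M <= L * (r / 4) by rewrite -ler_pdivlMr.
have tMr : t * M <= r / 4.
  by rewrite (le_trans tML) // ler_piMl // divr_ge0 ?ler0n // ltW.
have half u w : r <= `|u| -> `|w| <= r / 4 + r / 4 -> r / 2 <= `|u + w|.
  move=> ru wr; rewrite (le_trans _ (lerB_normD _ _)) //.
  have -> : r / 2 = r - (r / 4 + r / 4) by field.
  exact: lerB.
have td i : `|t * d i| <= r / 4.
  by rewrite normrM gtr0_norm // (le_trans _ tMr) // ler_pM2l.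
pose zz i := xx i + t * d i.
have sepB i j : xx i != xx j -> r / 2 <= `|zz i - zz j|.
  move=> xij; have -> : zz i - zz j = (xx i - xx j) + (t * d i - t * d j).
    by rewrite /zz; ring.
  apply: half; last by rewrite (le_trans (ler_normB _ _)) // lerD.
  apply: sep; last by rewrite subr_eq0.
  by rewrite mem_cat; apply/orP; left; apply: allpairs_f; rewrite mem_enum.
have sepD i j : xx i != - xx j -> r / 2 <= `|zz i + zz j|.
  move=> xij; have -> : zz i + zz j = (xx i + xx j) + (t * d i + t * d j).
    by rewrite /zz; ring.
  apply: half; last by rewrite (le_trans (ler_normD _ _)) // lerD.
  apply: sep; last by rewrite addr_eq0.
  by rewrite mem_cat; apply/orP; right; apply: allpairs_f; rewrite mem_enum.
have r2 : 0 < r / 2 by rewrite divr_gt0.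
have dE i j : xx i = xx j -> d i = d j.
  by move=> xij; rewrite /d (Allow_eq xy xij) -/(xx i) xij.
have dN i j : xx i = - xx j -> d i = - d j.
  by move=> xij; rewrite /d (Allow_opp xy xij) -/(xx i) xij /xx; ring.
have zE i j : zz i = zz j -> xx i = xx j.
  move=> zij; apply/eqP; apply: contraT => /sepB.
  by rewrite zij subrr normr0 => /(lt_le_trans r2); rewrite ltxx.
have zN i j : zz i = - zz j -> xx i = - xx j.
  move=> zij; apply/eqP; apply: contraT => /sepD.
  by rewrite zij addNr normr0 => /(lt_le_trans r2); rewrite ltxx.
pose c i := - (t * d i).
exists (\row_i zz i), (fun u => u + odd_tents zz c (r / 2) u); split.
- apply: odd_near_id_tents => //.
  have -> : \sum_i `|c i| = t * \sum_i `|d i|.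
    rewrite mulr_sumr; apply: eq_bigr => i _.
    by rewrite normrN normrM gtr0_norm.
  have -> : 2 / (r / 2) = (r / 4)^-1 by rewrite !invf_div mulrA -natrM.
  rewrite mulrC.
  rewrite ler_pdivrMr ?divr_gt0 // (le_trans _ tML) // ler_pM2l //.
  by rewrite lerDr ler01.
- move=> i; rewrite mxE odd_tents_interp //.
  + by rewrite /c /zz addrK.
  + by move=> j k /zE /dE; rewrite /c => ->.
  + by move=> j k /zN /dN; rewrite /c => ->; rewrite mulrN.
  + move=> j k zjk; apply: sepB; apply/eqP => xjk; apply: zjk.
    by rewrite /zz (dE _ _ xjk) xjk.
  move=> j k zjk; apply: sepD; apply/eqP => xjk; apply: zjk.
  by rewrite /zz (dN _ _ xjk) xjk; ring.
apply: contra_neq Pt => <-; rewrite PE.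
by apply: mpoly.meval_eq => i; rewrite mxE.
Qed.

Unset Implicit Arguments.

Theorem theorem4p8 (R : realType) (s : scalar_kind) (n : nat)
    (D : set 'rV[scalar_field R s]_n) (p : mpoly.mpoly n (scalar_field R s)) :
  (exists x : 'rV[scalar_field R s]_n,
     [/\ D x, general_position p x & Allow x `&` interior D !=set0]) ->
  ~ accurately_evaluable p D.
Proof.
move=> [x [Dx xG _]] [a [pa acc]].
have [px _] := xG; rewrite /variety /= in px.
have [y xy py] := general_position_nonvanishing xG.
(* Any [eta] will do, because it gets multiplied by [`|p x| = 0]. *)
have [|eps /andP[eps0 eps1] heps] := acc 2^-1.
  by rewrite invr_gt0 ltr0n invf_lt1 ?ltr1n ?ltr0n.
pose L := eps / 16.
have L0 : 0 < L by rewrite divr_gt0 ?ltr0n.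
have L16 : 16 * L = eps by rewrite /L; field.
have L4 : 4 * L <= 1.
  by rewrite (le_trans _ (ltW eps1)) // -L16 ler_pM2r // ler_nat.
have L1 : L <= 1 by rewrite (le_trans _ L4) // ler_peMl ?ler1n // ltW.
have [z [phi [hphi phiz pz]]] := exists_near_id_to L0 L1 xy py.
have [delta [hdelta deltaE]] := exact_run_emulated L0 L4 hphi a
  (v := fun i => z ord0 i) (w := fun i => x ord0 i) (fun i => esym (phiz i)).
(* As [p x = 0], the relative bound at [x] is an equality. *)
have := heps x delta Dx; rewrite px subr0 normr0 mulr0 normr_le0.
rewrite /p_comp deltaE -/(p_comp z (fun _ : comp_node a => 0)) pa => out0.
have {out0}/eqP : phi (peval p z) == 0.
  by apply: out0 => i; rewrite -L16; exact: hdelta.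
rewrite -(odd_near_id0 hphi) => /(odd_near_id_inj _ hphi) pz0.
by rewrite pz0 ?eqxx // ?(lt_le_trans _ L4) // ?ltr_pMl // ?ltr1n in pz.
Qed.
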